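(* Let $k$ be fixed, let $N=N(n)$, and let $(P_n)_{n\in\mathbb N}$ be a sequence of orthogonal projections $P_n\in M_k\otimes M_n$ of rank $N$, with $P_n=V_nV_n^*$ for isometries $V_n:\mathbb C^N\to\mathbb C^k\otimes\mathbb C^n$, and let $\Phi_n(X)=(\mathrm{id}_k\otimes\mathrm{Tr}_n)(V_nXV_n^* )$ be the associated quantum channels $M_N\to M_k$. Suppose $(P_n)$ satisfies condition $\mathcal C_1$ with limiting function $f$, and let $K=\{B\in D_k:\mathrm{Tr}[BA]\le f(A)\ \forall A\in D_k\}$ and $K_n=\Phi_n(D_N)$. Then $$K^\circ\subseteq\liminf_{n\to\infty}K_n\subseteq\limsup_{n\to\infty}K_n\subseteq K.$$
   Context: $D_d=\{A\in M_d(\mathbb C):A\ge0,\ \mathrm{Tr}A=1\}$. Condition $\mathcal C_m$: for every $A\in D_k$, the $m$ largest eigenvalues of $P_n(A\otimes I_n)P_n$ converge as $n\to\infty$ to a common limit $f(A)$. For sets, $\liminf_n S_n=\bigcup_{N}\bigcap_{n\ge N}S_n$ and $\limsup_n S_n=\bigcap_N\bigcup_{n\ge N}S_n$. $K^\circ$ denotes the interior of $K$ relative to the affine space of trace-one Hermitian $k\times k$ matrices (identified with $\mathbb R^{k^2-1}$). *)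

(* Defs.v *)
From HB Require Import structures.
From mathcomp Require Import all_boot all_order all_algebra.
From mathcomp Require Import complex mxtens.
From mathcomp Require Import all_classical all_reals all_analysis.
Set Implicit Arguments. Unset Strict Implicit. Unset Printing Implicit Defensive.
Import Order.TTheory GRing.Theory Num.Theory numFieldNormedType.Exports.
Local Open Scope ring_scope.
Local Open Scope classical_set_scope.

Section QDefs.
Variable R : realType.
Local Notation C := (R[i]).

Definition adjmx m n (M : 'M[C]_(m, n)) : 'M[C]_(n, m) := (map_mx Num.conj M)^T.

(* positive semidefinite: v^* A v >= 0 for all v (order of the
   numClosedField R[i]: 0 <= z means z is real and nonnegative) *)
Definition psdmx d (A : 'M[C]_d) : Prop :=
  forall v : 'cV[C]_d, 0 <= (adjmx v *m A *m v) 0 0.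

Definition Dset d : set 'M[C]_d := [set A | psdmx A /\ \tr A = 1].

Definition hermmx d (A : 'M[C]_d) : Prop := adjmx A = A.

(* largest eigenvalue of a (Hermitian) matrix: the supremum of its
   (real) eigenvalues; for Hermitian M this is the maximum eigenvalue *)
Definition lmax m (M : 'M[C]_m) : R := sup [set x : R | eigenvalue M (x%:C)%C].

(* partial trace id_k ⊗ Tr_n on M_k ⊗ M_n (index (i,l) of C^k⊗C^n is
   mxtens_index (i,l), consistent with the Kronecker product *t) *)
Definition ptrace2 k n (Y : 'M[C]_(k * n)) : 'M[C]_k :=
  \matrix_(i, j) \sum_(l < n) Y (mxtens_index (i, l)) (mxtens_index (j, l)).

Definition chan k n N (V : 'M[C]_(k * n, N)) (X : 'M[C]_N) : 'M[C]_k :=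
  ptrace2 (V *m X *m adjmx V).

Definition compressed k n (P : 'M[C]_(k * n)) (A : 'M[C]_k) : 'M[C]_(k * n) :=
  P *m (A *t (1%:M : 'M[C]_n)) *m P.

(* interior relative to the affine space of trace-one Hermitian matrices
   (topology of any norm; here the entrywise max norm) *)
Definition rel_interior d (K : set 'M[C]_d) : set 'M[C]_d :=
  [set B | hermmx B /\ \tr B = 1 /\
     exists2 e : R, 0 < e &
       forall B' : 'M[C]_d, hermmx B' -> \tr B' = 1 ->
         (forall i j, `|B' i j - B i j| < (e%:C)%C) -> K B'].

End QDefs.

Definition set_liminf T (S : nat -> set T) : set T :=
  \bigcup_(M in [set: nat]) \bigcap_(n in [set n | (M <= n)%N]) S n.
Definition set_limsup T (S : nat -> set T) : set T :=
  \bigcap_(M in [set: nat]) \bigcup_(n in [set n | (M <= n)%N]) S n.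

(* Main.v *)
(* The support function of K_n in the direction A is the largest eigenvalue of
   P_n (A (x) 1) P_n, which converges to f(A); this gives limsup K_n <= K.
   Conversely let B be interior to K.  For every traceless Hermitian H of norm
   one, the density matrix A = (1 + c H) / k satisfies Tr(B A) < f(A) strictly,
   so for large n some point of K_n lies beyond B in the direction H, with a
   margin.  Since the K_n are uniformly bounded, the same n works in a
   neighbourhood of H, hence for the whole compact sphere of directions.  Then B
   belongs to the compact convex set K_n: otherwise the direction from the point
   of K_n closest to B towards B would separate them. *)
Require Import Defs.
From HB Require Import structures.
From mathcomp Require Import all_boot all_order all_algebra.
From mathcomp Require Import complex mxtens.
From mathcomp Require Import all_classical all_reals all_analysis.
From mathcomp Require Import ring lra.
Import Order.TTheory GRing.Theory Num.Theory numFieldNormedType.Exports.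
Local Open Scope ring_scope.
Local Open Scope classical_set_scope.
Set Implicit Arguments. Unset Strict Implicit. Unset Printing Implicit Defensive.

(** * Positive semidefinite matrices, density matrices and the spectral theorem *)

Section Algebra.
Variable R : realType.
Local Notation C := R[i].

Lemma adjmxE m n (M : 'M[C]_(m, n)) i j : adjmx M i j = (M j i)^*.
Proof. by rewrite !mxE. Qed.

Lemma adjmxM m n p (A : 'M[C]_(m, n)) (B : 'M[C]_(n, p)) :
  adjmx (A *m B) = adjmx B *m adjmx A.
Proof. by rewrite /adjmx map_mxM trmx_mul. Qed.

Lemma adjmxK m n (A : 'M[C]_(m, n)) : adjmx (adjmx A) = A.
Proof. by apply/matrixP => i j; rewrite !adjmxE conjCK. Qed.

Lemma adjmxD m n (A B : 'M[C]_(m, n)) : adjmx (A + B) = adjmx A + adjmx B.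
Proof. by apply/matrixP => i j; rewrite !mxE rmorphD. Qed.

Lemma adjmxZ m n a (A : 'M[C]_(m, n)) : adjmx (a *: A) = a^* *: adjmx A.
Proof. by apply/matrixP => i j; rewrite !mxE rmorphM. Qed.

Lemma psdmx_congr m n (A : 'M[C]_m) (W : 'M[C]_(m, n)) :
  psdmx A -> psdmx (adjmx W *m A *m W).
Proof.
by move=> pA v; have := pA (W *m v); rewrite adjmxM !mulmxA.
Qed.

Lemma psdmxD n (A B : 'M[C]_n) : psdmx A -> psdmx B -> psdmx (A + B).
Proof. by move=> pA pB v; rewrite mulmxDr mulmxDl mxE addr_ge0. Qed.

Lemma psdmxZ n a (A : 'M[C]_n) : 0 <= a -> psdmx A -> psdmx (a *: A).
Proof. by move=> a0 pA v; rewrite -scalemxAr -scalemxAl mxE mulr_ge0. Qed.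

Lemma psdmx0 n : psdmx (0 : 'M[C]_n).
Proof. by move=> v; rewrite mulmx0 mul0mx mxE. Qed.

Lemma psdmx1 n : psdmx (1%:M : 'M[C]_n).
Proof.
move=> v; rewrite mulmx1 mxE sumr_ge0// => i _.
by rewrite adjmxE mulrC mul_conjC_ge0.
Qed.

Lemma psdmx_gram m n (W : 'M[C]_(m, n)) : psdmx (adjmx W *m W).
Proof. by have := psdmx_congr W (@psdmx1 m); rewrite mulmx1. Qed.

Lemma mx11D (A B : 'M[C]_1) : (A + B) 0 0 = A 0 0 + B 0 0.
Proof. by rewrite mxE. Qed.

(** Polarization: testing the quadratic form on two basis vectors with [c] among 0, 1, -1, i, -i
    gives access to single entries of [A]. *)
Lemma quad_delta2 n (A : 'M[C]_n) i j c :
  let v := delta_mx i 0 + c *: delta_mx j 0 : 'cV[C]_n in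
  (adjmx v *m A *m v) 0 0 =
    A i i + c * A i j + c^* * A j i + (c * c^*) * A j j.
Proof.
have q a b : (adjmx (delta_mx a 0 : 'cV[C]_n) *m A *m
    (delta_mx b 0 : 'cV[C]_n)) 0 0 = A a b.
  by rewrite /adjmx map_delta_mx trmx_delta -rowE -colE !mxE.
rewrite /= adjmxD adjmxZ !(mulmxDr, mulmxDl) -!(scalemxAl, scalemxAr).
have sc a (B : 'M[C]_1) : (a *: B) 0 0 = a * B 0 0 by rewrite mxE.
by rewrite !(mx11D, sc, q) !mulrA; ring.
Qed.

Lemma psdmx_diag_ge0 n (A : 'M[C]_n) i : psdmx A -> 0 <= A i i.
Proof.
move=> pA; have := pA (delta_mx i 0 + 0 *: delta_mx i 0).
by rewrite quad_delta2 !(mul0r, rmorph0, addr0).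
Qed.

(** In the order of [C], nonnegative values are real. Realness of the form at e_i, e_j, e_i + e_j
    and e_i + i e_j forces the entries (i,j) and (j,i) to be conjugate. *)
Lemma psdmx_herm n (A : 'M[C]_n) : psdmx A -> hermmx A.
Proof.
move=> pA; apply/matrixP => i j; rewrite adjmxE.
have /ger0_Im := psdmx_diag_ge0 i pA; have /ger0_Im := psdmx_diag_ge0 j pA.
have /ger0_Im := pA (delta_mx i 0 + 1 *: delta_mx j 0).
have /ger0_Im := pA (delta_mx i 0 + 'i%C *: delta_mx j 0).
rewrite !quad_delta2.
case: (A i i) (A j j) (A i j) (A j i) => [a a'] [b b'] [c c'] [d d'] /=.
move=> h1 h2 h3 h4; apply/eqP; rewrite eq_complex/=; apply/andP; split; apply/eqP; lra.
Qed.

(** Nonnegativity at e_i + c e_j for c = 1, -1, i, -i bounds twice the real and imaginary parts by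
    the sum of two diagonal entries, each in [0,1]. *)
Lemma dset_entry_le1 n (A : 'M[C]_n) i j : Dset A ->
  `|complex.Re (A i j)| <= 1 /\ `|complex.Im (A i j)| <= 1.
Proof.
move=> [pA trA].
have hA := psdmx_herm pA.
have eij : A j i = (A i j)^* by rewrite -adjmxE hA.
have d l : 0 <= A l l <= 1.
  rewrite psdmx_diag_ge0//= -trA /mxtrace (bigD1 l)//= lerDl sumr_ge0// => ? _.
  exact: psdmx_diag_ge0.
have := d i; have := d j.
have := pA (delta_mx i 0 + 1 *: delta_mx j 0).
have := pA (delta_mx i 0 + (-1) *: delta_mx j 0).
have := pA (delta_mx i 0 + 'i%C *: delta_mx j 0).
have := pA (delta_mx i 0 + (-'i%C) *: delta_mx j 0).
rewrite !quad_delta2 eij.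
case: (A i i) (A j j) (A i j) => [a a'] [b b'] [c c'] /=.
rewrite !lecE/= !ler_norml => /andP[_ h1] /andP[_ h2] /andP[_ h3] /andP[_ h4].
move=> /andP[] /andP[_ h5] /andP[_ h6] /andP[] /andP[_ h7] /andP[_ h8].
split; lra.
Qed.

Lemma spectral_decomposition n (A : 'M[C]_n) : hermmx A ->
  exists (U : 'M[C]_n) (d : 'I_n -> R), U *m adjmx U = 1%:M /\
    U *m A *m adjmx U = diag_mx (\row_i ((d i)%:C)%C).
Proof.
move=> hA.
have aE (M : 'M[C]_n) : adjmx M = map_mx Num.conj M^T by rewrite /adjmx map_trmx.
have hA' : A \is hermsymmx.
  by apply/is_hermitianmxP; rewrite expr0 scale1r -aE; exact: esym.
have uU := spectral_unitarymx A.
have := hermitian_spectral_diag_real hA'.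
have /orthomx_spectralP := hermitian_normalmx hA'.
rewrite invmx_unitary//; set U := spectralmx A; set D := spectral_diag A.
move/unitarymxP: uU; rewrite -/U -aE => uU eA Dr.
exists U, (fun i => complex.Re (D 0 i)); split => //.
rewrite [in LHS]eA !mulmxA uU mul1mx -!mulmxA uU mulmx1.
congr diag_mx; apply/rowP => i; rewrite mxE; apply/esym/RRe_real.
exact: (mxOverP Dr).
Qed.
End Algebra.

(** * Trace pairings and the largest eigenvalue *)

Section Trace.
Variable R : realType.
Local Notation C := R[i].

(** In an eigenbasis of [A] the pairing is a sum of eigenvalues weighted by the diagonal of the
    rotated [X]; for a density matrix [X] these weights are nonnegative with sum 1. *)
Lemma spectral_trace n (A X U : 'M[C]_n) (d : 'I_n -> R) :
  U *m adjmx U = 1%:M -> U *m A *m adjmx U = diag_mx (\row_i ((d i)%:C)%C) ->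
  \tr (X *m A) = \sum_i (U *m X *m adjmx U) i i * ((d i)%:C)%C.
Proof.
move=> uU uA; have uU' := mulmx1C uU.
have -> : \tr (X *m A) = \tr (U *m X *m adjmx U *m (U *m A *m adjmx U)).
  rewrite !mulmxA -(mulmxA (U *m X)) uU' mulmx1 [RHS]mxtrace_mulC.
  by rewrite !mulmxA uU' mul1mx.
by rewrite uA mul_mx_diag /mxtrace; apply: eq_bigr => i _; rewrite !mxE.
Qed.

Lemma psdmx_unitary n (A U : 'M[C]_n) : psdmx A -> psdmx (U *m A *m adjmx U).
Proof. by move=> /(psdmx_congr (adjmx U)); rewrite adjmxK. Qed.

Lemma psdmx_trM_ge0 n (A B : 'M[C]_n) :
  psdmx A -> psdmx B -> 0 <= \tr (A *m B).
Proof.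
move=> pA pB; have [U [d [uU uB]]] := spectral_decomposition (psdmx_herm pB).
rewrite (spectral_trace _ uU uB) sumr_ge0// => i _.
rewrite mulr_ge0 ?psdmx_diag_ge0//; first exact: psdmx_unitary.
have := psdmx_diag_ge0 i (psdmx_unitary U pB).
by rewrite uB !mxE eqxx mulr1n.
Qed.

Lemma trM_le_lmax n (A X : 'M[C]_n) : hermmx A -> Dset X ->
  \tr (X *m A) <= ((lmax A)%:C)%C.
Proof.
move=> hA [pX trX]; have [U [d [uU uA]]] := spectral_decomposition hA.
have uU' := mulmx1C uU.
have UA : U *m A = diag_mx (\row_i ((d i)%:C)%C) *m U.
  by rewrite -uA -!mulmxA uU' mulmx1.
have d_eig i : eigenvalue A ((d i)%:C)%C.
  apply/eigenvalueP; exists (row i U).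
    by rewrite -row_mul UA mul_diag_mx; apply/rowP => j; rewrite !mxE.
  apply/eqP => /(congr1 (fun v => v *m adjmx U)).
  rewrite -row_mul uU mul0mx => /rowP/(_ i); rewrite !mxE eqxx => /eqP.
  by rewrite oner_eq0.
have eig_d (a : R) : eigenvalue A (a%:C)%C -> exists i, a = d i.
  move=> /eigenvalueP[v vA v0]; pose w := v *m adjmx U.
  have w0 : w != 0.
    by apply: contra_neq v0 => w0; rewrite -[v]mulmx1 -uU' mulmxA -/w w0 mul0mx.
  have wD : w *m diag_mx (\row_i ((d i)%:C)%C) = (a%:C)%C *: w.
    by rewrite -uA !mulmxA /w -[v *m _ *m U]mulmxA uU' mulmx1 vA scalemxAl.
  have [i wi] := rV0Pn w w0; exists i.
    clearbody w.
  have /rowP/(_ i) := wD; rewrite mul_mx_diag !mxE mulrC.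
  by move=> /(mulIf wi)/complexI ->.
(* A supremum dominates its set only if the set is bounded above; every eigenvalue is some [d j], so
   the sum of all [|d j|] is a bound. *)
have d_le i : d i <= lmax A.
  apply: ub_le_sup => /=; last exact: d_eig.
  exists (\sum_j `|d j|) => a /= /eig_d[j ->].
  by rewrite (le_trans (ler_norm _))// (bigD1 j)//= lerDl sumr_ge0.
rewrite (spectral_trace _ uU uA).
have -> : ((lmax A)%:C)%C = \sum_i (U *m X *m adjmx U) i i * ((lmax A)%:C)%C.
  rewrite -mulr_suml -[X in X * _]/(\tr _) mxtrace_mulC mulmxA uU' mul1mx trX.
  by rewrite mul1r.
apply: ler_sum => i _; rewrite ler_wpM2l ?lecR// psdmx_diag_ge0//.
exact: psdmx_unitary.
Qed.

(** * Partial trace, and the support function of the image of a channel *)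

Lemma sum_mxtens_index (T : nmodType) k n (F : 'I_(k * n) -> T) :
  \sum_p F p = \sum_(i < k) \sum_(l < n) F (mxtens_index (i, l)).
Proof.
rewrite (reindex (@mxtens_index k n)) ?pair_bigA//=; last first.
  exists (@mxtens_unindex k n) => p _; first exact: mxtens_indexK.
  exact: mxtens_unindexK.
by apply: eq_bigr => -[].
Qed.

(** Duality between the partial trace and the map sending [A] to its tensor product with the
    identity; it turns statements on channel outputs into statements on the compressed matrix. *)
Lemma tr_ptrace2M k n (Y : 'M[C]_(k * n)) (A : 'M[C]_k) :
  \tr (ptrace2 Y *m A) = \tr (Y *m (A *t (1%:M : 'M[C]_n))).
Proof.
rewrite /mxtrace [RHS]sum_mxtens_index; apply: eq_bigr => i _.
rewrite mxE; under [RHS]eq_bigr do rewrite mxE sum_mxtens_index.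
rewrite exchange_big/=; apply: eq_bigr => j _; rewrite mxE mulr_suml.
apply: eq_bigr => l _; rewrite (bigD1 l)//= tensmxE mxE eqxx mulr1.
rewrite big1 ?addr0// => l' l'l.
by rewrite tensmxE mxE (negbTE l'l) !mulr0.
Qed.

Lemma tr_ptrace2 k n (Y : 'M[C]_(k * n)) : \tr (ptrace2 Y) = \tr Y.
Proof.
by rewrite /mxtrace sum_mxtens_index; apply: eq_bigr => i _; rewrite mxE.
Qed.

Lemma psdmx_ptrace2 k n (Y : 'M[C]_(k * n)) : psdmx Y -> psdmx (ptrace2 Y).
Proof.
(* [J l] embeds C^k as the slice of vectors x tensor e_l, so the partial trace is a sum of
   congruences of [Y]. *)
move=> pY; pose J l : 'M[C]_(k * n, k) :=
  \matrix_(p, i) (p == mxtens_index (i, l))%:R.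
have -> : ptrace2 Y = \sum_l adjmx (J l) *m Y *m J l.
  apply/matrixP => i j; rewrite mxE summxE; apply: eq_bigr => l _.
  rewrite mxE (bigD1 (mxtens_index (j, l)))//= !mxE eqxx mulr1.
  rewrite [X in _ + X]big1 ?addr0; last first.
    by move=> p pj; rewrite !mxE (negbTE pj) mulr0.
  rewrite (bigD1 (mxtens_index (i, l)))//= !mxE eqxx rmorph1 mul1r.
  rewrite big1 ?addr0// => p pj.
  by rewrite !mxE (negbTE pj) rmorph0 mul0r.
elim/big_ind : _ => [|A B|l _]; [exact: psdmx0|exact: psdmxD|].
exact: psdmx_congr.
Qed.

Lemma dset_isometry m n (V : 'M[C]_(m, n)) X :
  adjmx V *m V = 1%:M -> Dset X -> Dset (V *m X *m adjmx V).
Proof.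
move=> VV [pX trX]; split; last by rewrite mxtrace_mulC mulmxA VV mul1mx.
by have := psdmx_congr (adjmx V) pX; rewrite adjmxK.
Qed.

Lemma dset_chan k n N (V : 'M[C]_(k * n, N)) X :
  adjmx V *m V = 1%:M -> Dset X -> Dset (chan V X).
Proof.
move=> VV /(dset_isometry VV)[pY trY]; split; first exact: psdmx_ptrace2.
by rewrite /chan tr_ptrace2.
Qed.

Lemma herm_compressed k n N (V : 'M[C]_(k * n, N)) A :
  hermmx A -> hermmx (compressed (V *m adjmx V) A).
Proof.
move=> hA; rewrite /hermmx /compressed !adjmxM adjmxK.
rewrite [adjmx (_ *t _)]/adjmx map_mxT trmx_tens -/(adjmx A) hA map_mx1 trmx1.
by rewrite !mulmxA.
Qed.

(** With P = V V* one has P V = V, so compressing by P does not change the pairing with the state V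
    X V*, which [trM_le_lmax] bounds. *)
Lemma tr_chan_le k n N (V : 'M[C]_(k * n, N)) X A :
  adjmx V *m V = 1%:M -> Dset X -> hermmx A ->
  \tr (chan V X *m A) <= ((lmax (compressed (V *m adjmx V) A))%:C)%C.
Proof.
move=> VV dX hA.
have := trM_le_lmax (herm_compressed V hA) (dset_isometry VV dX).
rewrite /chan tr_ptrace2M /compressed !mulmxA -[V *m X *m _ *m V]mulmxA VV mulmx1.
rewrite [\tr (_ *m V *m adjmx V)]mxtrace_mulC !mulmxA VV mul1mx.
suff -> : \tr (V *m X *m adjmx V *m (A *t 1%:M)) =
          \tr (X *m adjmx V *m (A *t 1%:M) *m V) by rewrite ?mulmxA.
by rewrite -!mulmxA mxtrace_mulC !mulmxA.
Qed.

(** The bound of [tr_chan_le] is approached: an eigenvector for an eigenvalue above [t] lies in the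
    range of P, hence comes from a pure state on C^N. *)
Lemma tr_chan_gt k n N (V : 'M[C]_(k * n, N)) A (t : R) :
  adjmx V *m V = 1%:M -> 0 <= t -> t < lmax (compressed (V *m adjmx V) A) ->
  exists2 X, Dset X & (t%:C)%C < \tr (chan V X *m A).
Proof.
move=> VV t0 tl.
have [a /= aE ta] : exists2 a : R,
    eigenvalue (compressed (V *m adjmx V) A) (a%:C)%C & t < a.
  (* The supremum of the empty set is 0 by default, which 0 <= t < [lmax] excludes. *)
  apply: (sup_gt _ tl); apply/set0P/eqP => S0.
  by move: tl; rewrite /lmax S0 sup0 ltNge t0.
have a0 : (a%:C)%C != 0 by rewrite eq_complex/= negb_and gt_eqF// (le_lt_trans t0).
have /eigenvalueP[v vA v0] := aE.
set P := V *m adjmx V in vA.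
have PP : P *m P = P by rewrite /P !mulmxA -[V *m _ *m V]mulmxA VV mulmx1.
(* The compressed matrix ends with a factor P, so P fixes [a] times [v]; as [a] is nonzero, P fixes
   [v]. *)
have vP : v *m P = v.
  apply: (scalerI a0); rewrite scalemxAl -vA /compressed.
  by rewrite -(mulmxA v) -(mulmxA (P *m _) P) PP.
have hP : adjmx P = P by rewrite /P adjmxM adjmxK.
have Pv : P *m adjmx v = adjmx v by rewrite -{1}hP -adjmxM vP.
pose w := v *m V; pose s := (v *m adjmx v) 0 0.
have vs : v *m adjmx v = s%:M by rewrite {1}[_ *m _]mx11_scalar.
have s_gt0 : 0 < s.
  have [i vi] := rV0Pn v v0.
  rewrite /s mxE (bigD1 i)//= adjmxE ltr_wpDr//; last by rewrite mul_conjC_gt0.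
  by rewrite sumr_ge0// => j _; rewrite adjmxE mul_conjC_ge0.
(* The normalized pure state of [w], which is [v] pulled back through [V]; eigenvectors are row
   vectors, hence the adjoint on the left. *)
exists (s^-1 *: (adjmx w *m w)).
  split; first by apply: psdmxZ; [rewrite invr_ge0 ltW|exact: psdmx_gram].
  rewrite mxtraceZ mxtrace_mulC /w adjmxM !mulmxA -(mulmxA v) -/P vP vs.
  by rewrite mxtrace_scalar mulr1n mulVf// gt_eqF.
rewrite /chan tr_ptrace2M -scalemxAr -!scalemxAl mxtraceZ.
have -> : V *m (adjmx w *m w) *m adjmx V = adjmx v *m v *m P.
  by rewrite /w adjmxM !mulmxA -/P Pv.
clearbody P.
have -> : \tr (adjmx v *m v *m P *m (A *t 1%:M)) =
          \tr (v *m compressed P A *m adjmx v).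
  by rewrite /compressed -!mulmxA Pv [LHS]mxtrace_mulC -!mulmxA.
rewrite vA -scalemxAl mxtraceZ vs mxtrace_scalar mulr1n.
by rewrite mulrCA mulVf ?mulr1 ?ltcR// gt_eqF.
Qed.

End Trace.

(** * Convexity and compactness in real coordinates *)

Section Coordinates.
Variable R : realType.
Local Notation C := R[i].

Definition dot m (x y : 'rV[R]_m) : R := \sum_i x 0 i * y 0 i.

Lemma dotC m (x y : 'rV[R]_m) : dot x y = dot y x.
Proof. by apply: eq_bigr => i _; rewrite mulrC. Qed.

Lemma dotDl m (x y z : 'rV[R]_m) : dot (x + y) z = dot x z + dot y z.
Proof. by rewrite /dot -big_split; apply: eq_bigr => i _; rewrite mxE mulrDl. Qed.

Lemma dotZl m a (x z : 'rV[R]_m) : dot (a *: x) z = a * dot x z.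
Proof. by rewrite /dot mulr_sumr; apply: eq_bigr => i _; rewrite mxE mulrA. Qed.

Lemma dotDr m (x y z : 'rV[R]_m) : dot z (x + y) = dot z x + dot z y.
Proof. by rewrite dotC dotDl !(dotC _ z). Qed.

Lemma dotZr m a (x z : 'rV[R]_m) : dot z (a *: x) = a * dot z x.
Proof. by rewrite dotC dotZl (dotC _ z). Qed.

Lemma dot_ge0 m (x : 'rV[R]_m) : 0 <= dot x x.
Proof. by rewrite sumr_ge0// => i _; rewrite -expr2 sqr_ge0. Qed.

Lemma dot_gt0 m (x : 'rV[R]_m) : x != 0 -> 0 < dot x x.
Proof.
move=> x0; have [i xi] := rV0Pn x x0.
rewrite /dot (bigD1 i)//= ltr_wpDr//; last by rewrite -expr2 exprn_even_gt0.
by rewrite sumr_ge0// => j _; rewrite -expr2 sqr_ge0.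
Qed.

Lemma scalar_rV_continuous p (h : {scalar 'rV[R]_p}) : continuous (h : 'rV[R]_p -> R).
Proof.
have -> : (h : 'rV[R]_p -> R) = fun x => \sum_i x 0 i * h (delta_mx 0 i).
  apply/funext => x; rewrite {1}[x]row_sum_delta raddf_sum.
  by apply: eq_bigr => i _; exact: scalarZ.
apply: continuous_big => [|i _ x]; first exact: add_continuous.
apply: (@continuousM R _ (fun x : 'rV[R]_p => x 0 i) (cst (h (delta_mx 0 i)))).
  exact: coord_continuous.
exact: cst_continuous.
Qed.

Lemma linear_dist_continuous p m (g : {linear 'rV[R]_p -> 'rV[R]_m}) b :
  continuous (fun x => dot (b - g x) (b - g x)).
Proof.
have cg i : continuous (fun x : 'rV[R]_p => (b - g x) 0 i).
  have gi : scalar (fun x : 'rV[R]_p => g x 0 i).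
    by move=> a x y; rewrite linearP !mxE.
  pose G : {scalar 'rV[R]_p} :=
    HB.pack (fun x : 'rV[R]_p => g x 0 i) (GRing.isLinear.Build _ _ _ _ _ gi).
  have -> : (fun x : 'rV[R]_p => (b - g x) 0 i) = (fun x => b 0 i - G x).
    by apply/funext => x; rewrite !mxE.
  move=> x; apply: continuousB; first exact: cst_continuous.
  exact: scalar_rV_continuous.
apply: continuous_big => [|i _ x]; first exact: add_continuous.
exact: (@continuousM R _ _ _ x (cg i x) (cg i x)).
Qed.

(* If the minimizer x0 of |b - g x| were not mapped to b, moving from x0 towards
   a point of T lying strictly on the far side of b would decrease the distance. *)
Lemma convex_image_mem p m (T : set 'rV[R]_p)
    (g : {linear 'rV[R]_p -> 'rV[R]_m}) b :
  compact T -> T !=set0 ->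
  (forall x y (t : R), T x -> T y -> 0 <= t <= 1 -> T (x + t *: (y - x))) ->
  (forall x, T x -> g x != b ->
     exists2 y, T y & 0 < dot (g y - b) (b - g x)) ->
  exists2 x, T x & g x = b.
Proof.
move=> cT T0 convT sepT.
have [x /set_mem Tx minx] := compact_EVT_min T0 cT
  (continuous_subspaceT (@linear_dist_continuous _ _ g b)).
exists x => //; apply/eqP; apply/negPn/negP => gx.
have [y Ty ygt] := sepT x Tx gx.
pose u := b - g x; pose w := g y - g x.
have u0 : 0 < dot u u by rewrite dot_gt0// subr_eq0 eq_sym.
have uw : 0 < dot u w.
  have -> : w = (g y - b) + u by rewrite /w /u addrA subrK.
  by rewrite dotC dotDl addr_gt0.
have w0 := dot_ge0 w.
(* Along the segment the squared distance is |u|^2 - 2t u.w + t^2 |w|^2. This [t] satisfies t <= 1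
   and t |w|^2 <= u.w, so the distance squared drops by at least t u.w > 0. *)
pose t := dot u w / (dot u w + dot w w).
have den : 0 < dot u w + dot w w by rewrite ltr_pwDl.
have t0 : 0 < t by rewrite divr_gt0.
have t1 : t <= 1 by rewrite ler_pdivrMr// mul1r lerDl.
have := minx (x + t *: (y - x)).
rewrite inE => /(_ (convT _ _ _ Tx Ty _)); rewrite t1 ltW// => /(_ isT).
have -> : b - g (x + t *: (y - x)) = u + (- t) *: w.
  by rewrite linearD linearZ_LR linearB -/w opprD addrA -/u scaleNr.
rewrite -/u; clearbody u; rewrite dotDl !dotDr !dotZl !dotZr (dotC w u).
have tw : t * dot w w <= dot u w.
  rewrite /t mulrAC ler_pdivrMr// ler_wpM2l//; first exact: ltW.
  by rewrite lerDr ltW.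
nra.
Qed.

(** Since all [S n] share the bound [c], a margin [d] at [u] leaves a positive pairing on a ball
    around [u] whose radius does not depend on [n]; compactness then yields one threshold for all
    directions. *)
Lemma uniform_separation m (U : set 'rV[R]_m) (S : nat -> set 'rV[R]_m) b c :
  compact U -> (forall n y, S n y -> forall i, `|y 0 i| <= c) ->
  (forall u, U u -> exists2 d, 0 < d &
     \forall n \near \oo, exists2 y, S n y & d < dot (y - b) u) ->
  \forall n \near \oo, forall u, U u -> exists2 y, S n y & 0 < dot (y - b) u.
Proof.
move=> /compact_near_coveringP cU bS sepS.
pose P n u := exists2 y, S n y & 0 < dot (y - b) u.
apply: (cU _ _ P) => u /sepS[d d0 dS].
(* The sum bounds the l1 norm of y - b for [y] in any [S n], dual to the sup-norm balls on row
   vectors; the 1 keeps [D] positive. *)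
pose D := \sum_i (`|c| + `|b 0 i|) + 1.
have D0 : 0 < D by rewrite ltr_wpDl// sumr_ge0// => i _; rewrite addr_ge0.
have e0 : 0 < d / D by rewrite divr_gt0.
exists (ball u (d / D), [set n | exists2 y, S n y & d < dot (y - b) u]) => /=.
  by split => //; exact: nbhsx_ballx.
move=> [u' n] /= [[_ uu'] [y Sy dy]]; exists y => //.
have e : dot (y - b) u = dot (y - b) u' + dot (y - b) (u - u').
  by rewrite -dotDr [u' + _]addrC subrK.
suff : dot (y - b) (u - u') <= d by lra.
apply: (@le_trans _ _ (\sum_i (`|c| + `|b 0 i|) * (d / D))).
  apply: ler_sum => i _; rewrite (le_trans (ler_norm _))// normrM ler_pM//.
    rewrite !mxE (le_trans (ler_normB _ _))// lerD2r.
    by rewrite (le_trans (bS _ _ Sy i))// ler_norm.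
  by rewrite !mxE ltW//; exact: uu'.
rewrite -mulr_suml mulrA ler_pdivrMr// mulrC ler_wpM2l ?ltW//.
by rewrite ltrDl.
Qed.

End Coordinates.

(** * Real coordinates on Hermitian matrices *)

Section HermitianCoordinates.
Variable R : realType.
Local Notation C := R[i].

(* An isometry from the real n x n matrices onto the Hermitian ones: the
   symmetric part becomes the real part, the antisymmetric one the imaginary
   part. *)
Definition herm_of n (x : 'rV[R]_(n * n)) : 'M[C]_n :=
  \matrix_(i, j) Complex ((vec_mx x i j + vec_mx x j i) / 2)
                         ((vec_mx x i j - vec_mx x j i) / 2).

(** The inverse of [herm_of] on Hermitian matrices: real plus imaginary part puts the symmetric and
    antisymmetric parts together again. *)
Definition rv_of n (A : 'M[C]_n) : 'rV[R]_(n * n) :=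
  mxvec (\matrix_(i, j) (complex.Re (A i j) + complex.Im (A i j))).

Lemma conjCE (z : C) : z^* = Complex (complex.Re z) (- complex.Im z).
Proof. by case: z. Qed.

Lemma herm_of_herm n (x : 'rV[R]_(n * n)) : hermmx (herm_of x).
Proof.
apply/matrixP => i j; rewrite adjmxE conjCE !mxE /=.
by apply/eqP; rewrite eq_complex/=; apply/andP; split; apply/eqP; lra.
Qed.

Lemma herm_ofK n (x : 'rV[R]_(n * n)) : rv_of (herm_of x) = x.
Proof.
rewrite -[RHS]vec_mxK; congr mxvec; apply/matrixP => i j.
by rewrite !mxE /=; lra.
Qed.

Lemma hermmx_sym n (A : 'M[C]_n) i j : hermmx A ->
  complex.Re (A j i) = complex.Re (A i j) /\
  complex.Im (A j i) = - complex.Im (A i j).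
Proof. by move=> hA; rewrite -hA adjmxE conjCE hA. Qed.

Lemma rv_ofK n (A : 'M[C]_n) : hermmx A -> herm_of (rv_of A) = A.
Proof.
move=> hA; apply/matrixP => i j; have [eR eI] := hermmx_sym i j hA.
rewrite mxE /rv_of mxvecK !mxE eR eI.
by apply/eqP; rewrite eq_complex/=; apply/andP; split; apply/eqP; lra.
Qed.

Lemma herm_of_linear n a (x y : 'rV[R]_(n * n)) :
  herm_of (a *: x + y) = (a%:C)%C *: herm_of x + herm_of y.
Proof.
apply/matrixP => i j; rewrite !mxE.
by apply/eqP; rewrite eq_complex/=; apply/andP; split; apply/eqP; ring.
Qed.

Lemma herm_of0 n : herm_of (0 : 'rV[R]_(n * n)) = 0.
Proof.
have := herm_of_linear (-1) (0 : 'rV[R]_(n * n)) 0.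
by rewrite scaler0 addr0 rmorphN1 scaleN1r addNr.
Qed.

Lemma herm_ofZ n a (x : 'rV[R]_(n * n)) :
  herm_of (a *: x) = (a%:C)%C *: herm_of x.
Proof. by have := herm_of_linear a x 0; rewrite herm_of0 !addr0. Qed.

Lemma herm_ofB n (x y : 'rV[R]_(n * n)) :
  herm_of (x - y) = herm_of x - herm_of y.
Proof. by rewrite -scaleN1r addrC herm_of_linear rmorphN1 scaleN1r addrC. Qed.

Lemma rv_of_linear n a (A B : 'M[C]_n) :
  rv_of ((a%:C)%C *: A + B) = a *: rv_of A + rv_of B.
Proof.
rewrite /rv_of -linearP; congr mxvec; apply/matrixP => i j.
rewrite !mxE; case: (A i j) (B i j) => [c d] [e f] /=; ring.
Qed.

Lemma dot_vec_mx n (x y : 'rV[R]_(n * n)) :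
  dot x y = \sum_i \sum_j vec_mx x i j * vec_mx y i j.
Proof.
rewrite pair_bigA /dot (reindex _ (curry_mxvec_bij n n))/=.
by apply: eq_bigr => -[i j] _; rewrite !mxE.
Qed.

(** The trace pairing and the dot product agree only after the terms (i,j) and (j,i) are added; this
    reduces their equality to such pairs. *)
Lemma sum_eq_sym n (F G : 'I_n -> 'I_n -> C) :
  (forall i j, F i j + F j i = G i j + G j i) ->
  \sum_i \sum_j F i j = \sum_i \sum_j G i j.
Proof.
move=> FG; have dbl (H : 'I_n -> 'I_n -> C) :
    \sum_i \sum_j (H i j + H j i) = (\sum_i \sum_j H i j) *+ 2.
  rewrite mulr2n [X in _ = _ + X]exchange_big -big_split/=.
  by apply: eq_bigr => i _; rewrite big_split.
have n2 (a b : C) : a *+ 2 = b *+ 2 -> a = b.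
  by move/eqP; rewrite eqrMn2r// => /eqP.
apply: n2; rewrite -!dbl.
by apply: eq_bigr => i _; apply: eq_bigr => j _.
Qed.

Lemma tr_mul_herm_of n (A : 'M[C]_n) (u : 'rV[R]_(n * n)) : hermmx A ->
  \tr (A *m herm_of u) = ((dot (rv_of A) u)%:C)%C.
Proof.
move=> hA; rewrite dot_vec_mx rmorph_sum/=.
under [RHS]eq_bigr do rewrite rmorph_sum/=.
rewrite /mxtrace; under [LHS]eq_bigr do rewrite mxE.
apply: sum_eq_sym => i j; have [eR eI] := hermmx_sym i j hA.
rewrite /rv_of mxvecK !mxE.
case: (A i j) (A j i) eR eI => [a b] [c d] /= -> ->.
by apply/eqP; rewrite eq_complex/=; apply/andP; split; apply/eqP; field.
Qed.

Lemma rv_of_dset_le2 n (A : 'M[C]_n) i : Dset A -> `|rv_of A 0 i| <= 2.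
Proof.
move=> dA; case/mxvec_indexP: i => i j; rewrite mxvecE mxE.
have [r1 i1] := dset_entry_le1 i j dA.
by rewrite (le_trans (ler_normD _ _))//; lra.
Qed.

Lemma bounded_set_rV m (A : set 'rV[R]_m) (M : R) :
  (forall x, A x -> forall i, `|x 0 i| <= M) -> bounded_set A.
Proof.
move=> AM; exists `|M|; split; first exact: normr_real.
move=> N MN x Ax; rewrite /Num.norm/= mx_normrE; apply/bigmax_leP; split.
  by rewrite (le_trans _ (ltW MN)).
move=> [i j] _; rewrite ord1/= (le_trans (AM _ Ax j))//.
by rewrite (le_trans (ler_norm _))// ltW.
Qed.

Lemma scalar_continuous m (h : 'rV[R]_m -> R) : scalar h -> continuous h.
Proof.
move=> hl; pose H : {scalar 'rV[R]_m} :=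
  HB.pack h (GRing.isLinear.Build _ _ _ _ _ hl).
exact: (@scalar_rV_continuous _ _ H).
Qed.

Lemma Re_quad_scalar n (v : 'cV[C]_n) :
  scalar (fun x => complex.Re ((adjmx v *m herm_of x *m v) 0 0)).
Proof.
move=> a x y; rewrite herm_of_linear mulmxDr mulmxDl -scalemxAr -scalemxAl.
rewrite mxE [X in complex.Re (X + _)]mxE.
by move: (_ 0 0) (_ 0 0) => [b c] [d e] /=; ring.
Qed.

Lemma Re_tr_scalar n :
  scalar (fun x : 'rV[R]_(n * n) => complex.Re (\tr (herm_of x))).
Proof.
move=> a x y; rewrite herm_of_linear mxtraceD mxtraceZ.
by move: (\tr _) (\tr _) => [b c] [d e] /=; ring.
Qed.

Lemma hermmx_trE n (A : 'M[C]_n) : hermmx A ->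
  \tr A = ((complex.Re (\tr A))%:C)%C.
Proof.
move=> hA; apply/esym/RRe_real/CrealP.
by rewrite -[in RHS]hA /adjmx mxtrace_tr trace_map_mx.
Qed.

Lemma hermmx_quadE n (A : 'M[C]_n) (v : 'cV[C]_n) : hermmx A ->
  (adjmx v *m A *m v) 0 0 = ((complex.Re ((adjmx v *m A *m v) 0 0))%:C)%C.
Proof.
move=> hA; apply/esym/RRe_real/CrealP.
by rewrite -adjmxE !adjmxM adjmxK hA mulmxA.
Qed.

Definition dset_coord n : set 'rV[R]_(n * n) := [set x | Dset (herm_of x)].

Lemma dset_coord_compact n : compact (@dset_coord n).
Proof.
apply: bounded_closed_compact.
  apply: (@bounded_set_rV _ _ 2) => x dx i.
  by rewrite -[x]herm_ofK rv_of_dset_le2.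
(* Closed conditions on real parts suffice, since the trace and the quadratic form of [herm_of x]
   are real. *)
have -> : @dset_coord n =
    (\bigcap_(v in [set: 'cV[C]_n])
       [set x | 0 <= complex.Re ((adjmx v *m herm_of x *m v) 0 0)])
    `&` [set x | complex.Re (\tr (herm_of x)) = 1].
  apply/seteqP; split => x /=.
    move=> [px tx]; split; last by rewrite tx.
    by move=> v _ /=; have := px v; rewrite lecE => /andP[].
  move=> [px tx]; split; last by rewrite hermmx_trE ?tx//; exact: herm_of_herm.
  move=> v; rewrite hermmx_quadE; last exact: herm_of_herm.
  by rewrite ler0c; exact: (px v).
apply: closedI.
  apply: closed_bigI => v _.
  apply: (@closed_comp _ _ _ [set r : R | 0 <= r]); last exact: closed_ge.
  by move=> x _; apply: scalar_continuous; exact: Re_quad_scalar.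
apply: (@closed_comp _ _ _ [set r : R | r = 1]); last exact: closed_eq.
by move=> x _; apply: scalar_continuous; exact: Re_tr_scalar.
Qed.

Lemma dset_coord_convex n x y (t : R) :
  @dset_coord n x -> @dset_coord n y -> 0 <= t <= 1 ->
  @dset_coord n (x + t *: (y - x)).
Proof.
move=> [px tx] [py ty] /andP[t0 t1]; rewrite /dset_coord/=.
have -> : x + t *: (y - x) = (1 - t) *: x + t *: y.
  by rewrite scalerBr scalerBl scale1r addrCA addrC.
rewrite herm_of_linear herm_ofZ; split.
  by apply: psdmxD; apply: psdmxZ; rewrite ?ler0c ?subr_ge0.
by rewrite mxtraceD !mxtraceZ tx ty !mulr1 -rmorphD/= subrK.
Qed.

End HermitianCoordinates.

(** * Channel images, and density matrices attached to directions *)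

Section Channels.
Variable R : realType.
Local Notation C := R[i].

Lemma chan_linear k n N (V : 'M[C]_(k * n, N)) a X Y :
  chan V (a *: X + Y) = a *: chan V X + chan V Y.
Proof.
rewrite /chan mulmxDr mulmxDl -scalemxAr -scalemxAl.
apply/matrixP => i j; rewrite !mxE mulr_sumr -big_split/=.
by apply: eq_bigr => l _; rewrite !mxE.
Qed.

(** [convex_image_mem] for the compact convex set of density matrices in coordinates, with the
    channel as the linear map. *)
Lemma chan_mem k n N (V : 'M[C]_(k * n, N)) B :
  adjmx V *m V = 1%:M -> (exists X, @Dset R N X) -> hermmx B ->
  (forall X, Dset X -> chan V X <> B -> exists2 Y, Dset Y &
     0 < dot (rv_of (chan V Y) - rv_of B) (rv_of B - rv_of (chan V X))) ->
  exists2 X, Dset X & chan V X = B.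
Proof.
move=> VV [X0 dX0] hB sepB.
have coordK X : Dset X -> dset_coord (rv_of X).
  by move=> dX; rewrite /dset_coord/= rv_ofK//; exact: psdmx_herm dX.1.
have gl : linear (fun x => rv_of (chan V (herm_of x))).
  by move=> a x y; rewrite herm_of_linear chan_linear rv_of_linear.
pose g : {linear 'rV[R]_(N * N) -> 'rV[R]_(k * k)} :=
  HB.pack (fun x => rv_of (chan V (herm_of x)))
    (GRing.isLinear.Build _ _ _ _ _ gl).
have [||x y t||x dx gx] :=
    @convex_image_mem R _ _ (@dset_coord R N) g (rv_of B).
- exact: dset_coord_compact.
- by exists (rv_of X0); exact: coordK.
- exact: dset_coord_convex.
- move=> x dx gx; have [|Y dY Ygt] := sepB _ dx.
    by move=> e; move: gx; rewrite /g/= e eqxx.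
  by exists (rv_of Y); [exact: coordK|rewrite /g/= (rv_ofK (psdmx_herm dY.1))].
- exists (herm_of x) => //.
  rewrite -[RHS]rv_ofK// -gx rv_ofK//.
  exact: psdmx_herm (dset_chan VV dx).1.
Qed.

Lemma psdmx_diag n (d : 'I_n -> R) : (forall i, 0 <= d i) ->
  psdmx (diag_mx (\row_i ((d i)%:C)%C)).
Proof.
move=> d0 v; rewrite mul_mx_diag mxE sumr_ge0// => i _.
by rewrite !mxE mulrAC mulr_ge0 ?ler0c// mulrC mul_conjC_ge0.
Qed.

Lemma psdmx_perturb1 n (H : 'M[C]_n) : hermmx H ->
  exists2 c : R, 0 < c & psdmx (1%:M + (c%:C)%C *: H).
Proof.
move=> hH; have [U [d [uU uH]]] := spectral_decomposition hH.
(* With c = 1/s every eigenvalue of c H has absolute value at most 1, so adding the identity leaves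
   a nonnegative spectrum. *)
have uU' := mulmx1C uU; pose s := 1 + \sum_i `|d i|.
have s0 : 0 < s by rewrite ltr_pwDl// sumr_ge0.
exists s^-1; first by rewrite invr_gt0.
have -> : 1%:M + ((s^-1)%:C)%C *: H =
    adjmx U *m diag_mx (\row_i ((1 + s^-1 * d i)%:C)%C) *m U.
  have -> : diag_mx (\row_i ((1 + s^-1 * d i)%:C)%C) =
      U *m (1%:M + ((s^-1)%:C)%C *: H) *m adjmx U.
    rewrite mulmxDr mulmxDl mulmx1 uU -scalemxAr -scalemxAl uH.
    apply/matrixP => i j; rewrite !mxE; case: eqP => _.
      by rewrite !mulr1n rmorphD rmorphM rmorph1.
    by rewrite !mulr0n mulr0 addr0.
  by rewrite !mulmxA uU' mul1mx -mulmxA uU' mulmx1.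
apply/psdmx_congr/psdmx_diag => i.
have : `|s^-1 * d i| <= 1.
  rewrite normrM gtr0_norm ?invr_gt0// mulrC ler_pdivrMr// mul1r.
  by rewrite /s (bigD1 i)//= addrCA lerDl addr_ge0// sumr_ge0.
by rewrite ler_norml => /andP[h _]; lra.
Qed.

(** The unit directions of the affine space of trace-one Hermitian matrices. *)
Definition traceless_sphere n : set 'rV[R]_(n * n) :=
  [set u | \tr (herm_of u) = 0 /\ dot u u = 1].

Lemma traceless_sphere_compact n : compact (@traceless_sphere n).
Proof.
apply: bounded_closed_compact.
  apply: (@bounded_set_rV _ _ _ 1) => x [_ x1] i.
  have : x 0 i * x 0 i <= 1.
    rewrite -x1 /dot (bigD1 i)//= lerDl sumr_ge0// => j _.
    by rewrite -expr2 sqr_ge0.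
  by move=> h; rewrite ler_norml; apply/andP; split; nra.
(* The norm is written as a distance to 0 so that [linear_dist_continuous] applies. *)
have -> : @traceless_sphere n =
    [set x | complex.Re (\tr (herm_of x)) = 0] `&`
    [set x | dot (0 - idfun x) (0 - idfun x) = 1].
  have eN (x : 'rV[R]_(n * n)) : dot (0 - idfun x) (0 - idfun x) = dot x x.
    by rewrite sub0r /idfun -scaleN1r dotZl dotZr mulrA mulrNN !mul1r.
  apply/seteqP; split => x.
    by move=> [t0 x1]; split; rewrite /= ?eN ?t0.
  move=> [/= t0]; rewrite eN => x1; split=> //.
  by rewrite (hermmx_trE (herm_of_herm x)) t0.
apply: closedI.
  apply: (@closed_comp _ _ _ [set r : R | r = 0]); last exact: closed_eq.
  by move=> x _; apply: scalar_continuous; exact: Re_tr_scalar.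
apply: (@closed_comp _ _ _ [set r : R | r = 1]); last exact: closed_eq.
by move=> x _; exact: (@linear_dist_continuous R _ _ idfun 0).
Qed.

Lemma entry_scale_lt n (H : 'M[C]_n) (e : R) : 0 < e ->
  exists2 a : R, 0 < a & forall i j, `|(a%:C)%C * H i j| < (e%:C)%C.
Proof.
move=> e0; pose s := 1 + \sum_i \sum_j complex.Re `|H i j|.
have ReN z : `|z| = ((complex.Re `|z|)%:C)%C by rewrite RRe_real// normr_real.
have N0 (z : C) : 0 <= complex.Re `|z| by rewrite -ler0c -ReN.
have s0 : 0 < s.
  by rewrite ltr_pwDl// sumr_ge0// => i _; rewrite sumr_ge0.
exists (e / s) => [|i j]; first by rewrite divr_gt0.
rewrite normrM ger0_norm ?ler0c ?divr_ge0 ?ltW//.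
rewrite ReN -rmorphM ltcR mulrAC ltr_pdivrMr// ltr_pM2l//.
rewrite /s (bigD1 i)//= (bigD1 j)//=.
have h1 : 0 <= \sum_(j0 < n | j0 != j) complex.Re `|H i j0|.
  by rewrite sumr_ge0.
have h2 : 0 <= \sum_(i0 < n | i0 != i) \sum_j complex.Re `|H i0 j|.
  by rewrite sumr_ge0// => i0 _; rewrite sumr_ge0.
lra.
Qed.

Definition perturbed_id n (c : R) (u : 'rV[R]_(n * n)) : 'M[C]_n :=
  (n%:R)^-1 *: (1%:M + (c%:C)%C *: herm_of u).

Lemma dset_perturbed_id n c u : (0 < n)%N -> \tr (herm_of u) = 0 ->
  psdmx (1%:M + (c%:C)%C *: herm_of u) -> Dset (@perturbed_id n c u).
Proof.
move=> n0 tu pu; split; first by apply: psdmxZ; rewrite ?invr_ge0.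
rewrite mxtraceZ mxtraceD mxtraceZ tu mulr0 addr0 mxtrace1 mulVf//.
by rewrite pnatr_eq0 -lt0n.
Qed.

(** For c > 0 and n > 0 this is an increasing affine function of the component of [Z] along [u], so
    bounds against density matrices become bounds in the direction [u]. *)
Lemma tr_perturbed_id n c u (Z : 'M[C]_n) : hermmx Z -> \tr Z = 1 ->
  \tr (Z *m perturbed_id c u) =
  (((n%:R)^-1 * (1 + c * dot (rv_of Z) u))%:C)%C.
Proof.
move=> hZ tZ; rewrite -scalemxAr mxtraceZ mulmxDr mxtraceD mulmx1 tZ.
rewrite -scalemxAr mxtraceZ tr_mul_herm_of//.
by rewrite rmorphM rmorphD rmorphM rmorph1 fmorphV rmorph_nat.
Qed.

End Channels.

(** * The three inclusions *)

Theorem theorem3p8 (R : realType) (k : nat) (N : nat -> nat)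
    (V : forall n : nat, 'M[R[i]]_(k * n, N n))
    (f : 'M[R[i]]_k -> R) :
  (forall n, adjmx (V n) *m V n = 1%:M) ->
  (forall A, Dset A ->
     lmax (compressed (V n *m adjmx (V n)) A) @[n --> \oo] --> (f A : R)) ->
  let K := [set B | Dset B /\ forall A, Dset A -> \tr (B *m A) <= ((f A)%:C)%C] in
  let Kn := fun n => [set chan (V n) X | X in @Dset R (N n)] in
  rel_interior K `<=` set_liminf Kn /\
  set_liminf Kn `<=` set_limsup Kn /\
  set_limsup Kn `<=` K.
Proof.
move=> VV cvg_f K Kn; split; last split; last first.
- move=> B BKn.
  have dB : Dset B.
    by have [n _ [X dX <-]] := BKn 0%N I; exact: dset_chan.
  split=> // A dA; have /ger0_real/RRe_real tE := psdmx_trM_ge0 dB.1 dA.1.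
  rewrite -tE lecR leNgt; apply/negP => fB.
  (* Eventually [lmax] falls below Tr(BA), yet [B] lies in [Kn n] for arbitrarily large n,
     contradicting [tr_chan_le]. *)
  have [M _ HM] := @cvgr_lt _ _ _ _ _ _ (cvg_f A dA) _ fB.
  have [n /= Mn [X dX XB]] := BKn M I.
  have := tr_chan_le (VV n) dX (psdmx_herm dA.1).
  by rewrite XB -tE lecR leNgt HM.
- move=> B [M _ HM] M' _; exists (maxn M M') => /=; first exact: leq_maxr.
  by apply: HM => /=; exact: leq_maxl.
move=> B [hB [tB [e e0 KB]]].
have [dB fB] : K B.
  by apply: KB => // i j; rewrite subrr normr0 ltcR.
have k0 : (0 < k)%N.
  by case: k B tB {V f VV cvg_f K Kn hB e e0 KB dB fB} => // B /eqP;
     rewrite /mxtrace big_ord0 eq_sym oner_eq0.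
have k0' : 0 < (k%:R^-1 : R) by rewrite invr_gt0 ltr0n.
have near_tr A (t : R) : Dset A -> 0 <= t -> t < f A ->
    \forall n \near \oo, exists2 X, @Dset R (N n) X &
      (t%:C)%C < \tr (chan (V n) X *m A).
  move=> dA t0 tA.
  apply: filterS (@cvgr_gt _ _ _ _ _ _ (cvg_f A dA) _ tA) => n.
  exact: tr_chan_gt.
(* A priori [N n] could be 0. At the maximally mixed state f is at least 1/k > 0, because [B] is in
   [K]; so [near_tr] with t = 0 provides a state. *)
have near_nonempty : \forall n \near \oo, exists X, @Dset R (N n) X.
  have t0 : \tr (herm_of (0 : 'rV[R]_(k * k))) = 0 by rewrite herm_of0 mxtrace0.
  have d1 : Dset (perturbed_id 0 (0 : 'rV[R]_(k * k))).
    by apply: dset_perturbed_id => //; rewrite scale0r addr0; exact: psdmx1.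
  have := fB _ d1; rewrite tr_perturbed_id// lecR mul0r addr0 mulr1 => f1.
  apply: filterS (near_tr _ 0 d1 (lexx _) (lt_le_trans k0' f1)) => n.
  by move=> [X dX _]; exists X.
have near_sep : \forall n \near \oo, forall u, @traceless_sphere R k u ->
    exists2 y, (@rv_of R k @` Kn n) y & 0 < dot (y - rv_of B) u.
  apply: (@uniform_separation R _ _ _ _ 2).
  - exact: traceless_sphere_compact.
  - move=> n _ [_ [X dX <-] <-] i; apply: rv_of_dset_le2; exact: dset_chan.
  move=> u [tu uu].
  have [c c0 pu] := psdmx_perturb1 (herm_of_herm u).
  (* The step [a] is small enough that [B] moved by [a] along [u] stays in [K]; this gives the
     strict gap Tr(BA) < f(A). *)
  have [a a0 au] := entry_scale_lt (herm_of u) e0.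
  pose A := perturbed_id c u.
  have dA : Dset A by exact: dset_perturbed_id.
  pose B' := herm_of (a *: u + rv_of B).
  have B'E : B' = (a%:C)%C *: herm_of u + B by rewrite /B' herm_of_linear rv_ofK.
  have tB' : \tr B' = 1 by rewrite B'E mxtraceD mxtraceZ tu mulr0 add0r.
  have [_ /(_ A dA)] : K B'.
    apply: KB => // [|i j]; first exact: herm_of_herm.
    by rewrite B'E !mxE addrK; have := au i j; rewrite !mxE.
  rewrite tr_perturbed_id//; last exact: herm_of_herm.
  rewrite lecR herm_ofK dotDl dotZl uu mulr1 => fA.
  have := psdmx_trM_ge0 dB.1 dA.1.
  rewrite tr_perturbed_id// ler0c => tBA.
  have ca : 0 < c * a by rewrite mulr_gt0.
  exists (a / 2); first by rewrite divr_gt0.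
  (* The pairing with [A] of a point lying a/2 beyond [B] along [u]: above Tr(BA) >= 0, and below
     f(A), which dominates the value at the full step [a]. *)
  pose t := k%:R^-1 * (1 + c * (a / 2 + dot (rv_of B) u)).
  have t0 : 0 <= t.
    by apply: (le_trans tBA); rewrite ler_pM2l//; lra.
  have tf : t < f A.
    by apply: (lt_le_trans _ fA); rewrite ltr_pM2l//; lra.
  apply: filterS (near_tr _ _ dA t0 tf) => n [X dX].
  have [pX tX] := dset_chan (VV n) dX.
  rewrite (tr_perturbed_id _ _ (psdmx_herm pX) tX) ltcR ltr_pM2l// ltrD2l.
  rewrite ltr_pM2l// => X_gt.
  exists (rv_of (chan (V n) X)); first by exists (chan (V n) X) => //; exists X.
  by rewrite -scaleN1r dotDl dotZl mulN1r ltrBrDr.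
have [M _ HM] : \forall n \near \oo, Kn n B.
  apply: filterS2 near_nonempty near_sep => n neD sep.
  have [X dX XB|X dX XB] := chan_mem (VV n) neD hB; last by exists X.
  have [pX tX] := dset_chan (VV n) dX.
  pose w := rv_of B - rv_of (chan (V n) X).
  have w0 : 0 < dot w w.
    apply: dot_gt0; rewrite subr_eq0; apply/eqP => eBX; apply: XB.
    by rewrite -(rv_ofK (psdmx_herm pX)) -eBX rv_ofK.
  (* Both [B] and the channel output have trace 1, so the normalized difference is on the traceless
     sphere; the positive factor is then cancelled. *)
  have [|_ [_ [Y dY <-] <-] Ygt] := sep ((Num.sqrt (dot w w))^-1 *: w).
    split.
      rewrite herm_ofZ mxtraceZ /w herm_ofB !rv_ofK//; last exact: psdmx_herm.
      by rewrite raddfB/= tB tX subrr mulr0.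
    rewrite dotZl dotZr mulrA -expr2 exprVn sqr_sqrtr ?dot_ge0// mulVf//.
    by rewrite gt_eqF.
  exists Y => //; move: Ygt; rewrite dotZr pmulr_rgt0// invr_gt0.
  by rewrite sqrtr_gt0.
by exists M => // n /= Mn; exact: HM.
Qed.
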